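(* Let $G$ be a completely metrizable topological group, and let $\kappa$ be a cardinal satisfying $1 \leq \kappa \leq \aleph_0$. Then $G_\kappa$ is dense in $G^\kappa$ if and only if $G_\kappa$ is comeagre in $G^\kappa$.
   Context: For a cardinal $\kappa>0$ and a group $G$, $G_\kappa$ denotes the set of $\kappa$-tuples $(g_i)_{i\in\kappa}\in G^\kappa$ that freely generate a free subgroup of $G$, i.e. such that no nontrivial reduced group word in the indexed variables $(x_i)_{i\in\kappa}$ evaluates to $1$ at $(g_i)_{i\in\kappa}$ (equivalently, the homomorphism from the free group on $\{x_i\}_{i\in\kappa}$ to $G$ sending $x_i\mapsto g_i$ is injective). $G^\kappa$ carries the product topology. A space is completely metrizable if its topology is induced by some complete metric. A subset is nowhere dense if its closure contains no nonempty open subset, and comeagre if it is the complement of a countable union of nowhere dense sets. *)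

(* Defs.v *)
From HB Require Import structures.
From mathcomp Require Import all_boot all_order all_algebra.
From mathcomp Require Import all_classical all_reals all_analysis.

Set Implicit Arguments.
Unset Strict Implicit.
Unset Printing Implicit Defensive.

Import Order.TTheory GRing.Theory Num.Theory.

Local Open Scope classical_set_scope.
Local Open Scope ring_scope.

HB.mixin Record PreTopologicalGroup_isTopologicalGroup G
    & Topological G & monoid.Group G := {
  mulg_continuous : continuous (fun x : G * G => (x.1 * x.2)%g) ;
  invg_continuous : continuous (fun x : G => (x^-1)%g)
}.

#[short(type="topologicalGroupType")]
HB.structure Definition TopologicalGroup :=
  {G of Topological G & monoid.Group G & PreTopologicalGroup_isTopologicalGroup G}.

(* The metric is existentially quantified rather than part of the structure of
   T, since complete metrizability only concerns the topology. *)
Definition completely_metrizable (R : realType) (T : topologicalType) : Prop :=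
  exists d : T -> T -> R,
    [/\ (forall x y, d x y = 0 <-> x = y),
        (forall x y, d x y = d y x),
        (forall x y z, d x z <= d x y + d y z),
        (forall x : T, nbhs x =
           filter_from [set e : R | 0 < e] (fun e => [set y | d x y < e]))
      & (forall u : nat -> T,
           (forall e : R, 0 < e -> exists N : nat, forall m n : nat,
              (N <= m)%N -> (N <= n)%N -> d (u m) (u n) < e) ->
           exists l : T, u @ \oo --> l)].

Definition nowhere_dense (T : topologicalType) (A : set T) : Prop :=
  forall U : set T, open U -> U `<=` closure A -> U = set0.

(* Finite unions are covered, as set0 is nowhere dense. *)
Definition comeagre (T : topologicalType) (A : set T) : Prop :=
  exists F : nat -> set T,
    (forall n, nowhere_dense (F n)) /\ ~` A = \bigcup_n F n.

(* The letter (i, false) stands for x_i and (i, true) for its inverse. *)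
Definition word (I : Type) := seq (I * bool).

Definition reduced (I : Type) (w : word I) : Prop :=
  forall (u v : word I) (i : I) (b : bool),
    w <> u ++ [:: (i, b), (i, ~~ b) & v].

Definition word_eval (I : Type) (G : groupType) (g : I -> G) (w : word I) : G :=
  (\prod_(l <- w) (if l.2 then (g l.1)^-1 else g l.1))%g.

Definition free_tuples (I : Type) (G : groupType) : set (I -> G) :=
  [set g | forall w : word I, reduced w -> w <> [::] -> word_eval g w <> 1%g].

(* Main.v *)
(** The complement of the set of free tuples is the union, over the countably
    many nontrivial reduced words [w], of the sets of tuples where [w]
    evaluates to [1]. These sets are closed, so as soon as free tuples are
    dense each of them is nowhere dense. The converse is the Baire category
    theorem for a countable power of a completely metrizable space, obtained
    from a decreasing sequence of cylinders constraining more and more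
    coordinates with smaller and smaller radii. *)
Require Import Defs.
From mathcomp Require Import all_boot all_order all_algebra.
From mathcomp Require Import all_classical all_reals all_analysis.
From mathcomp Require Import lra.

Local Open Scope classical_set_scope.

Import Order.TTheory GRing.Theory Num.Theory.

Lemma coord_continuous (I : Type) (T : I -> topologicalType) (i : I) :
  continuous (fun g : prod_topology T => g i).
Proof.
move=> g A nA.
have /cvg_sup/(_ i) : nbhs g --> (g : prod_topology T) by [].
by apply; exact: (@initial_continuous _ _ (fun g : forall i, T i => g i)).
Qed.

Lemma cvg_prod_coord (I : Type) (T : I -> topologicalType)
    (F : set_system (prod_topology T)) (g : prod_topology T) :
  Filter F -> (forall i, (fun h : prod_topology T => h i) @ F --> g i) ->
  F --> g.
Proof.
move=> FF Fg; apply/cvg_sup => i A.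
have /= -> := @nbhsE (initial_topology (fun h : forall i, T i => h i)) g.
case=> B [[C oC <-] Cg] /filterS; apply.
by apply: (Fg i); exact: open_nbhs_nbhs.
Qed.

Lemma word_eval_continuous (I : Type) (G : topologicalGroupType) (w : word I) :
  continuous (fun g : prod_topology (fun _ : I => G) => word_eval g w).
Proof.
elim: w => [|[i b] w IHw] g.
  rewrite (_ : (fun h => _) = cst 1%g); first exact: cst_continuous.
  by apply/funext => h; rewrite /word_eval big_nil.
pose letter (h : prod_topology (fun _ : I => G)) : G :=
  if b then ((h i)^-1)%g else h i.
rewrite (_ : (fun h => _) = (fun x : G * G => (x.1 * x.2)%g) \o
    (fun h => (letter h, word_eval h w))); last first.
  by apply/funext => h; rewrite /word_eval big_cons.
have letter_continuous : continuous letter.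
  rewrite /letter; case: b {letter} => h; last first.
    exact: (@coord_continuous I (fun=> G) i).
  apply: (@continuous_comp _ _ _ (fun h : prod_topology (fun=> G) => h i)
    (fun x : G => (x^-1)%g)); first exact: (@coord_continuous I (fun=> G) i).
  exact: invg_continuous.
apply: continuous_comp; last exact: mulg_continuous.
apply: (@cvg_pair _ _ _ (nbhs g)); last exact: IHw.
exact: letter_continuous.
Qed.

(** Relabelling the letters by natural numbers is injective, and lists over a countable type are
    countable. The code serves to index the closed sets attached to words by [nat]. *)
Lemma countable_word (I : Type) : countable [set: I] ->
  exists code : word I -> nat, injective code.
Proof.
move=> /countable_injP[f f_inj].
have fI : injective f by move=> x y; apply: f_inj; rewrite inE.
exists (fun w => pickle [seq (f l.1, l.2) | l <- w]).
apply: inj_comp; first exact: (pcan_inj pickleK).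
by apply: inj_map => -[i b] [j c] [/fI -> ->].
Qed.

Lemma metric_ge0 (R : realType) (T : Type) (d : T -> T -> R) :
  (forall x y, d x y = 0%R <-> x = y) -> (forall x y, d x y = d y x) ->
  (forall x y z, (d x z <= d x y + d y z)%R) -> forall x y, (0 <= d x y)%R.
Proof.
move=> d0 dC dt x y; have := dt x y x; rewrite (dC y x).
by have /d0 -> := erefl x; lra.
Qed.

Lemma dense_free_tuples_comeagre (R : realType) (G : topologicalGroupType)
    (I : Type) : completely_metrizable R G -> countable [set: I] ->
  @dense (prod_topology (fun _ : I => G)) (@free_tuples I G) ->
  @comeagre (prod_topology (fun _ : I => G)) (@free_tuples I G).
Proof.
move=> [d [d0 dC dt nbhsd _]] /countable_word[code codeI] free_dense.
(* Since [code] is injective, at most one word contributes to the set of index [n]; the set is empty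
   when [n] is not the code of a nontrivial reduced word. *)
exists (fun n => [set g : prod_topology (fun _ : I => G) | exists w : word I,
  [/\ code w = n, reduced w, w <> [::] & word_eval g w = 1%g]]); split.
  move=> n U oU clU; apply: contrapT => /eqP/set0P U0.
  have [g [Ug g_free]] := free_dense U U0 oU.
  (* Meeting the whole space only shows that the set is nonempty, which yields the word [w] with
     code [n]. *)
  have [_ [[w [cw rw w0 _]] _]] := clU g Ug setT filterT.
  have : nbhs g [set h : prod_topology (fun _ : I => G) | word_eval h w <> 1%g].
    apply: (@word_eval_continuous I G w g [set x | x <> 1%g]).
    (* The open ball around the value of [w] with this radius just misses [1]. *)
    rewrite nbhsd; exists (d (word_eval g w) 1%g) => [|x /= dx x1].
      rewrite /= lt_neqAle eq_sym; apply/andP; split.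
        by apply/eqP => /d0; exact: g_free.
      exact: metric_ge0 d0 dC dt _ _.
    by rewrite x1 ltxx in dx.
  move=> /(clU g Ug)[h [[v [cv _ _ hv]] /=]]; apply.
  by rewrite (codeI w v) // cw cv.
apply/seteqP; split=> [g /=|g [n _ [w [_ rw w0 gw]]] g_free].
  move=> /existsNP[w /not_implyP[rw /not_implyP[w0 /contrapT gw]]].
  by exists (code w) => //; exists w.
exact: (g_free w).
Qed.

Lemma exists_invS_lt (R : realType) (e : R) : (0 < e)%R ->
  exists n : nat, (n.+1%:R^-1 < e)%R.
Proof. by move=> /ltr_add_invr[n]; rewrite add0r => ?; exists n. Qed.

Section baire.
Context (R : realType) (T : topologicalType) (d : T -> T -> R).
Hypotheses (d_eq0 : forall x y, d x y = 0%R <-> x = y)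
  (dC : forall x y, d x y = d y x)
  (d_triangle : forall x y z, (d x z <= d x y + d y z)%R)
  (nbhsd : forall x : T, nbhs x =
    filter_from [set e : R | (0 < e)%R] (fun e => [set y | (d x y < e)%R]))
  (d_complete : forall u : nat -> T,
    (forall e : R, (0 < e)%R -> exists N : nat, forall m n : nat,
       (N <= m)%N -> (N <= n)%N -> (d (u m) (u n) < e)%R) ->
    exists l : T, u @ \oo --> l).
Context (I : Type) (f : I -> nat) (f_inj : injective f).

Local Notation X := (prod_topology (fun _ : I => T)).

(** As [f] is injective, finitely many coordinates are constrained. The bound is not strict, so that
    it survives passage to coordinatewise limits. *)
Definition cylinder (x : X) (n : nat) (e : R) : set X :=
  [set y | forall i, (f i < n)%N -> (d (x i) (y i) <= e)%R].

Lemma nbhs_cylinder x n e : (0 < e)%R -> nbhs x (cylinder x n e).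
Proof.
move=> e0; elim: n => [|n IHn]; first by apply: filterS filterT.
(* Going from [n] to [n.+1] adds at most one constrained coordinate, and none when [n] is not a
   value of [f]. *)
have [[j jn]|nj] := pselect (exists j, f j = n); last first.
  apply: filterS IHn => y xy i; rewrite ltnS leq_eqVlt => /predU1P[fi|/xy//].
  by case: nj; exists i.
have : nbhs x [set y : X | (d (x j) (y j) < e)%R].
  apply: (@coord_continuous I (fun _ => T) j x [set z | (d (x j) z < e)%R]).
  by rewrite nbhsd; exists e.
move=> /filterI/(_ IHn); apply: filterS => y [/= xyj xy] i.
rewrite ltnS leq_eqVlt => /predU1P[|/xy//].
by rewrite -jn => /f_inj ->; exact: ltW.
Qed.

(** The cylinders around [x] generate a filter that converges to [x] in each coordinate, hence in
    the product; so it contains every neighbourhood of [x]. *)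
Lemma nbhs_cylinderE x (A : set X) : nbhs x A ->
  exists n e, (0 < e)%R /\ cylinder x n e `<=` A.
Proof.
pose F := filter_from [set p : nat * R | (0 < p.2)%R]
  (fun p => cylinder x p.1 p.2).
have FF : Filter F.
  apply: filter_from_filter; first by exists (0%N, 1%R); rewrite /= ltr01.
  move=> [m e] [n e'] /= e0 e'0; exists (maxn m n, Num.min e e').
    by rewrite /= lt_min e0.
  move=> y xy; split=> i fi; (apply: le_trans (xy i _) _;
    [by rewrite leq_max fi ?orbT|by rewrite /= ge_min lexx ?orbT]).
have : F --> x.
  apply: cvg_prod_coord => i A'; rewrite nbhsd => -[e /= e0 eA].
  exists ((f i).+1, (e / 2)%R); rewrite /= ?divr_gt0// => y /(_ i (ltnSn _)) xy.
  by apply: eA => /=; lra.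
by move=> Fx /Fx[[n e] /= e0 xA]; exists n, e.
Qed.

Lemma comeagre_dense (A : set X) : comeagre A -> dense A.
Proof.
move=> [F [F_nd FA]] O [x0 Ox0] oO.
(* A state consists of the centre, coordinate bound and radius of a cylinder; [P] says what stage
   [n] must achieve. *)
pose P (s s' : X * nat * R) (n : nat) := [/\ (0 < s'.2)%R,
  (s'.2 <= n.+1%:R^-1)%R, (n < s'.1.2)%N, 
  cylinder s'.1.1 s'.1.2 s'.2 `<=` cylinder s.1.1 s.1.2 s.2 &
  cylinder s'.1.1 s'.1.2 s'.2 `<=` ~` F n].
have step (p : nat * (X * nat * R)) : exists s', (0 < p.2.2)%R -> P p.2 s' p.1.
  case: p => n [[x m] e] /=; have [e0|] := pselect (0 < e)%R; last first.
    (* A default value: nothing is required when the radius is not positive. *)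
    by exists (x, m, e).
  have [y [yC yF]] : exists y, (cylinder x m e)° y /\ ~ closure (F n) y.
    (* Otherwise the interior of the cylinder lies in the closure of [F n], hence is empty, although
       it contains [x]. *)
    apply: contrapT => /forallNP CF.
    have : (cylinder x m e)° x by exact: nbhs_cylinder.
    rewrite (F_nd n _ (open_interior _))// => y yC.
    by apply: contrapT => yF; apply: (CF y).
  have : nbhs y ((cylinder x m e)° `&` ~` closure (F n)).
    apply: open_nbhs_nbhs; split=> //; apply: openI; first exact: open_interior.
    by rewrite openC; exact: closed_closure.
  move=> /nbhs_cylinderE[k [r [r0 yr]]].
  exists (y, maxn k n.+1, (Num.min r n.+1%:R^-1)%R) => _.
  have yr' : cylinder y (maxn k n.+1) (Num.min r n.+1%:R^-1)%R `<=`
      (cylinder x m e)° `&` ~` closure (F n).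
    move=> z yz; apply: yr => i fi; apply: le_trans (yz i _) _.
      by rewrite leq_max fi.
    by rewrite ge_min lexx.
  split=> //=.
  - by rewrite lt_min r0 invr_gt0 ltr0n.
  - by rewrite ge_min lexx orbT.
  - by rewrite leq_max leqnn orbT.
  - by move=> z /yr'[/interior_subset].
  - by move=> z /yr'[_ zF] Fz; apply: zF; exact: subset_closure.
have [next nextP] := choice step.
have [n0 [e0 [e0_gt0 x0O]]] := nbhs_cylinderE _ _ (open_nbhs_nbhs (conj oO Ox0)).
pose s := fix s n : X * nat * R := if n is n'.+1 then next (n', s n') else (x0, n0, e0).
have s_gt0 n : (0 < (s n).2)%R.
  by elim: n => [//|n IHn]; have [] := nextP (n, s n) IHn.
have sP n : P (s n) (s n.+1) n by exact: nextP (n, s n) (s_gt0 n).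
pose C n := cylinder (s n).1.1 (s n).1.2 (s n).2.
have C_dec m n : (m <= n)%N -> C n `<=` C m.
  elim: n => [|n IHn]; first by rewrite leqn0 => /eqP ->.
  rewrite leq_eqVlt => /predU1P[->//|]; rewrite ltnS => /IHn; apply: subset_trans.
  by have [] := sP n.
have C_center m n i : (m <= n)%N -> (f i < (s m).1.2)%N ->
    (d ((s m).1.1 i) ((s n).1.1 i) <= (s m).2)%R.
  move=> mn fi; apply: (C_dec m n mn) => // j _.
  (* Each centre lies in its own cylinder, hence in all earlier ones. *)
  by have /d_eq0 -> := erefl ((s n).1.1 j); exact: ltW.
have C_cvg i : exists l : T, (fun n => (s n).1.1 i : T) @ \oo --> l.
  apply: (d_complete (fun n => (s n).1.1 i)) => e e_gt0.
  have [k ke] : exists k : nat, (k.+1%:R^-1 < e / 2)%R.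
    by apply: exists_invS_lt; lra.
  (* From this stage on, coordinate [i] is constrained and the radius is below [e / 2], so two later
     centres are compared through the centre of stage [N]. *)
  pose N := (maxn k (f i)).+1; exists N => m n Nm Nn.
  have [_ sN fN _ _] := sP (maxn k (f i)).
  have fi : (f i < (s N).1.2)%N.
    by apply: leq_ltn_trans fN; rewrite leq_maxr.
  have sNe : ((s N).2 < e / 2)%R.
    apply: le_lt_trans sN (le_lt_trans _ ke).
    by rewrite lef_pV2 ?posrE ?ltr0n// ler_nat ltnS leq_maxl.
  have := C_center N m i Nm fi; have := C_center N n i Nn fi.
  have := d_triangle ((s m).1.1 i) ((s N).1.1 i) ((s n).1.1 i).
  by rewrite (dC ((s m).1.1 i) ((s N).1.1 i)); lra.
have [l lP] := choice C_cvg.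
have Cl n : C n l.
  (* A later centre within [e] of [l] at coordinate [i] gives the bound up to [e]. *)
  move=> i fi; apply/ler_addgt0Pr => e e_gt0.
  have : nbhs (l i) [set y | (d (l i) y < e)%R] by rewrite nbhsd; exists e.
  move=> /(lP i)[N _ /(_ (maxn N n))]; rewrite /= leq_maxl => /(_ isT) lN.
  have := C_center n (maxn N n) i (leq_maxr _ _) fi.
  have := d_triangle ((s n).1.1 i) ((s (maxn N n)).1.1 i) (l i).
  by move: lN; rewrite /= (dC (l i)); lra.
exists l; split; first exact/x0O/(Cl 0%N).
apply: contrapT => Al.
have [n _ Fl] : (\bigcup_n F n) l by rewrite -FA.
(* Stage [n] made the cylinder of index [n.+1] disjoint from [F n]. *)
by have [_ _ _ _ /(_ l (Cl n.+1))] := sP n.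
Qed.

End baire.

Theorem lemma3 (R : realType) (G : topologicalGroupType)
    (hG : completely_metrizable R G)
    (I : Type) (hI1 : [set: I] !=set0) (hIc : countable [set: I]) :
  @dense (prod_topology (fun _ : I => G)) (@free_tuples I G) <->
  @comeagre (prod_topology (fun _ : I => G)) (@free_tuples I G).
Proof.
split; first exact: (dense_free_tuples_comeagre R).
have [d [d0 dC dt nbhsd dcomp]] := hG.
have /countable_injP[f f_inj] := hIc.
apply: (@comeagre_dense R G d d0 dC dt nbhsd dcomp I f) => x y.
by apply: f_inj; rewrite inE.
Qed.
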